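(* Let $p>1$ and $0<u<p$ be real and $d$ a positive integer. Let $n,r$ be integers with $1\le r\le\min\{d,n\}$. The probability that a partition $\lambda$ chosen from $P_{d,u}$ has size $n$ and exactly $r$ parts equals \[ \frac{u^n\,(u/p)_d\,(1/p)_d}{p^{r^2}\,(1/p)_{d-r}\,(1/p)_r}\cdot\frac{(1/p)_{n-1}}{p^{n-r}\,(1/p)_{r-1}\,(1/p)_{n-r}}. \]
   Context: Write $(x)_i=(1-x)(1-x/p)\cdots(1-x/p^{i-1})$ (with $(x)_0=1$). For a partition $\lambda$: $|\lambda|=\sum\lambda_i$, $m_i(\lambda)$ is the number of parts equal to $i$, $\lambda_i'$ is the length of the $i$-th column of its diagram, and $r(\lambda)=\lambda_1'$ its number of parts. The probability measure $P_{d,u}$ on partitions is $P_{d,u}(\lambda)=\frac{u^{|\lambda|}}{p^{\sum_i(\lambda_i')^2}\prod_i (1/p)_{m_i(\lambda)}}\prod_{i=1}^d(1-u/p^i)\prod_{i=d-r(\lambda)+1}^d(1-1/p^i)$ if $r(\lambda)\le d$, and $0$ otherwise. *)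

(* Defs.v *)
From HB Require Import structures.
From mathcomp Require Import all_boot all_order all_algebra.
From mathcomp Require Import classical_sets reals ereal esum.
Set Implicit Arguments.
Unset Strict Implicit.
Unset Printing Implicit Defensive.
Import Order.TTheory GRing.Theory Num.Theory.
Local Open Scope ring_scope.

(* The parts are listed in weakly decreasing order, without trailing zeros. *)
Record intpart : Type := IntPart {
  parts :> seq nat;
  _ : sorted geq parts && (0%N \notin parts) }.

HB.instance Definition _ := [isSub for parts].
HB.instance Definition _ := [Choice of intpart by <:].

Definition psize (l : intpart) : nat := sumn l.

Definition mult (i : nat) (l : intpart) : nat := count_mem i l.

(* The i-th column (i >= 1) has one cell for each part that is >= i. *)
Definition col (i : nat) (l : intpart) : nat := count (leq i) l.

Definition nparts (l : intpart) : nat := col 1 l.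

Definition largest (l : intpart) : nat := head 0%N l.

Definition qpoch (R : realType) (p x : R) (i : nat) : R :=
  \prod_(0 <= j < i) (1 - x / p ^+ j).

(* The sum of (l'_i)^2 and the product over m_i(l) range over all i >= 1; for
   i > l_1 the terms are 0 and 1 respectively, so both stop at l_1. *)
Definition Pdu (R : realType) (p : R) (d : nat) (u : R) (l : intpart) : R :=
  if (nparts l <= d)%N then
    u ^+ psize l
    / (p ^+ (\sum_(1 <= i < (largest l).+1) col i l ^ 2)%N
       * \prod_(1 <= i < (largest l).+1) qpoch p p^-1 (mult i l))
    * \prod_(1 <= i < d.+1) (1 - u / p ^+ i)
    * \prod_((d - nparts l).+1 <= i < d.+1) (1 - 1 / p ^+ i)
  else 0.

(* The probability of an event: the sum of its (nonnegative) point masses. *)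
Definition Pr_du (R : realType) (p : R) (d : nat) (u : R)
    (A : set intpart) : \bar R :=
  (\esum_(l in A) (Pdu p d u l)%:E)%E.

(* Main.v *)
Require Import Defs.
From HB Require Import structures.
From mathcomp Require Import all_boot all_order all_algebra.
From mathcomp Require Import classical_sets reals ereal esum.
From mathcomp Require Import cardinality fsbigop zify ring.
Set Implicit Arguments.
Unset Strict Implicit.
Unset Printing Implicit Defensive.
Import Order.TTheory GRing.Theory Num.Theory.
Local Open Scope ring_scope.

(** Deleting the first column of a partition of [n] with [r] parts leaves a
    partition of [n - r] with some number [s <= r] of parts, and divides the
    weight [1 / (p ^ sum (l'_i)^2 * prod (1/p)_(m_i))] by
    [1 / (p ^ (r ^ 2) * (1/p)_(r - s))].  By induction on the number of columns,
    the closed form for the total weight amounts to an instance of the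
    q-Vandermonde identity with [q = 1/p]; the remaining factors of the measure depend only
    on [n] and [r]. *)

(** * Gaussian binomial coefficients *)

(** The Gaussian binomial is taken from a q-Pascal rule rather than as a quotient, so that
    q-Vandermonde needs no division. *)
Fixpoint qbinom (R : pzRingType) (q : R) (n k : nat) : R :=
  match n, k with
  | _, 0 => 1
  | 0, _.+1 => 0
  | n'.+1, k'.+1 => qbinom q n' k' + q ^+ k'.+1 * qbinom q n' k'.+1
  end.

Lemma qbinomn0 (R : pzRingType) (q : R) (n : nat) : qbinom q n 0 = 1.
Proof. by case: n. Qed.

Lemma qbinom_small (R : pzRingType) (q : R) (n k : nat) :
  (n < k)%N -> qbinom q n k = 0.
Proof.
elim: n k => [|n IHn] [|k] //= lt_nk.
by rewrite !IHn ?mulr0 ?addr0 // ltnW.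
Qed.

(** Induction on [a]: the Pascal rule is applied to [a.+1 + b] on the left and to each
    [qbinom q a.+1 i.+1] on the right, and the terms match one by one. *)
Lemma qbinom_Vandermonde (R : comPzRingType) (q : R) (a b k : nat) :
  qbinom q (a + b)%N k =
  \sum_(i < k.+1)
    qbinom q a i * qbinom q b (k - i)%N * q ^+ ((k - i) * (a - i))%N.
Proof.
elim: a k => [|a IHa] k.
  rewrite big_ord_recl big1 => [|i _]; last by rewrite !mul0r.
  by rewrite qbinomn0 mul1r subn0 muln0 expr0 mulr1 addr0.
case: k => [|k]; first by rewrite big_ord1 subnn !qbinomn0 mul0n expr0 !mulr1.
rewrite addSn /= !IHa [X in _ + _ * X]big_ord_recl [RHS]big_ord_recl.
rewrite !qbinomn0 !mul1r !subn0 mulrDr addrCA; congr (_ + _).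
  by rewrite mulrCA -exprD mulnS.
rewrite big_distrr -big_split; apply: eq_bigr => i _ /=.
rewrite /bump !leq0n !add1n !subSS /= mulrDl mulrDl; congr (_ + _).
(* For [a <= i] the truncated subtraction spoils the exponent identity below, but there
   [qbinom q a i.+1] is 0. *)
have [lt_ai|le_ia] := leqP a i.
  by rewrite (@qbinom_small _ q a i.+1) // ?mulr0 !mul0r ?mulr0.
have -> : ((k - i) * (a - i) = (k - i) + (k - i) * (a - i.+1))%N.
  by rewrite -mulnS -subSn // subSS.
have le_ik : (i <= k)%N by rewrite -ltnS.
rewrite -{1}(subnKC le_ik) -addSn !exprD; ring.
Qed.

(** In the Pascal rule the two terms contribute the factors [1 - q ^+ a.+1] and
    [q ^+ a.+1 * (1 - q ^+ b.+1)], whose sum is the last factor of the right-hand product. *)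
Lemma qbinomM (R : comPzRingType) (q : R) (a b : nat) :
  qbinom q (a + b)%N a
    * ((\prod_(0 <= j < a) (1 - q ^+ j.+1)) * \prod_(0 <= j < b) (1 - q ^+ j.+1))
  = \prod_(0 <= j < (a + b)%N) (1 - q ^+ j.+1).
Proof.
pose P k := \prod_(0 <= j < k) (1 - q ^+ j.+1).
have P0 : P 0 = 1 by rewrite /P big_nil.
have PS k : P k.+1 = P k * (1 - q ^+ k.+1) by rewrite /P big_nat_recr.
rewrite -!/(P _).
elim: a b => [|a IHa] b; first by rewrite qbinomn0 P0 !mul1r.
elim: b => [|b IHb].
  have := IHa 0; rewrite !addn0 P0 !mulr1 /= => H.
  by rewrite (@qbinom_small _ q a a.+1) // mulr0 addr0 !PS mulrA H.
have {}IHa := IHa b.+1; rewrite addSn /= [P (a + _).+1]PS -IHa.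
rewrite addSnnS -IHa in IHb.
rewrite mulrDl -[q ^+ _ * _ * _]mulrA.
have -> : qbinom q (a + b.+1) a.+1 * (P a.+1 * P b.+1) =
    qbinom q (a + b.+1) a * (P a * P b.+1) * (1 - q ^+ b.+1).
  by rewrite -IHb [P b.+1]PS; ring.
by rewrite PS -addSn exprD; ring.
Qed.

(** * Inserting and deleting a first column, and enumerating partitions by columns *)

Definition add_column (r : nat) (l : seq nat) : seq nat :=
  map succn l ++ nseq (r - size l) 1%N.

Definition drop_column (l : seq nat) : seq nat :=
  [seq x.-1 | x <- l & (1 < x)%N].

Lemma add_columnK (r : nat) (l : seq nat) :
  0%N \notin l -> drop_column (add_column r l) = l.
Proof.
rewrite /drop_column filter_cat map_cat => l0.
have -> : [seq x <- nseq (r - size l) 1%N | (1 < x)%N] = [::].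
  by elim: (_ - _)%N.
rewrite cats0; elim: l l0 => //= x l IHl; rewrite inE negb_or => /andP[x0 l0].
by rewrite ltnS lt0n eq_sym x0 /= IHl.
Qed.

Lemma size_drop_column (l : seq nat) : (size (drop_column l) <= size l)%N.
Proof. by rewrite size_map size_filter count_size. Qed.

Lemma drop_columnK (l : seq nat) :
  sorted geq l -> 0%N \notin l -> add_column (size l) (drop_column l) = l.
Proof.
rewrite /add_column /drop_column size_map -map_comp.
elim: l => //= x l IHl pl; rewrite inE negb_or => /andP[x0 l0].
case: ltnP => [x1|x1] /=.
  by rewrite subSS IHl ?(path_sorted pl) // prednK // lt0n eq_sym.
have {x0 x1}ex : x = 1%N by lia.
rewrite {x}ex in pl *.
(* Below a part 1 only ones can follow, so the rest of [l] is exactly the padding that [add_column]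
   supplies. *)
have l1 : all (pred1 1%N) l.
  have /allP al := order_path_min (rev_trans leq_trans) pl.
  apply/allP => y ly; have := al _ ly; rewrite /= => y1.
  have y0 : y != 0%N by apply: contraNneq l0 => <-.
  lia.
have -> : [seq x <- l | (1 < x)%N] = [::].
  by apply/eqP; rewrite -size_eq0 size_filter -leqn0 leqNgt -has_count;
    apply/hasPn => y /(allP l1)/eqP ->.
by rewrite /=; congr (_ :: _); apply/esym/all_pred1P.
Qed.

Lemma sumn_add_column (r : nat) (l : seq nat) :
  (size l <= r)%N -> sumn (add_column r l) = (r + sumn l)%N.
Proof.
move=> ler; rewrite sumn_cat sumn_nseq mul1n.
have -> : sumn (map succn l) = (sumn l + size l)%N.
  by elim: {ler} l => //= x l ->; lia.
lia.
Qed.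

Lemma size_add_column (r : nat) (l : seq nat) :
  (size l <= r)%N -> size (add_column r l) = r.
Proof. by move=> ler; rewrite size_cat size_map size_nseq subnKC. Qed.

Lemma add_column_neq0 (r : nat) (l : seq nat) : 0%N \notin add_column r l.
Proof.
rewrite mem_cat negb_or mem_nseq andbF andbT.
by apply/mapP => -[].
Qed.

Lemma sorted_add_column (r : nat) (l : seq nat) :
  sorted geq l -> sorted geq (add_column r l).
Proof.
rewrite /add_column; move: (_ - _)%N => k sl.
have sn : forall x, (0 < x)%N -> path geq x (nseq k 1%N).
  by elim: k => //= k IHk x ->; rewrite IHk.
case: l sl => [_|x l] /=; first by case: (k) (sn 1%N isT) => //= ? /andP[].
elim: l x => /= [|y l IHl] x; first by rewrite sn.
by move=> /andP[yx pl]; rewrite ltnS yx IHl.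
Qed.

(* The partitions of [n] into [r] parts, all at most [k]. *)
Fixpoint enum_parts (k n r : nat) : seq (seq nat) :=
  if k isn't k'.+1 then (if (n == 0)%N && (r == 0)%N then [:: [::]] else [::])
  else if (r <= n)%N then
    [seq add_column r l | s <- iota 0 r.+1, l <- enum_parts k' (n - r) s]
  else [::].

Lemma enum_partsS (k n r : nat) : enum_parts k.+1 n r =
  if (r <= n)%N then
    [seq add_column r l | s <- iota 0 r.+1, l <- enum_parts k (n - r) s]
  else [::].
Proof. by []. Qed.

Lemma enum_partsP (k n r : nat) (l : seq nat) : l \in enum_parts k n r ->
  [/\ sorted geq l, 0%N \notin l, sumn l = n & size l = r].
Proof.
elim: k n r l => [|k IHk] n r l; rewrite ?enum_partsS.
  by rewrite /=; case: ifP => // /andP[/eqP-> /eqP->]; rewrite inE => /eqP->.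
case: ifP => // lern /allpairsPdep[s [m [sr /IHk[sm m0 summ sizem] ->]]].
have ler : (size m <= r)%N by rewrite sizem -ltnS; move: sr; rewrite mem_iota.
split; rewrite ?sorted_add_column ?add_column_neq0 ?size_add_column //.
by rewrite sumn_add_column // summ subnKC.
Qed.

(** Deleting the first column lowers the bound [k] on the parts by one, which drives the
    induction. *)
Lemma mem_enum_parts (k : nat) (l : seq nat) :
  sorted geq l -> 0%N \notin l -> all (fun x => x <= k)%N l ->
  l \in enum_parts k (sumn l) (size l).
Proof.
elim: k l => [|k IHk] l sl l0 lk.
  by case: l sl l0 lk => //= -[|x] l.
have szl : (size l <= sumn l)%N.
  by elim: l l0 {sl lk} => //= x l IHl; rewrite inE negb_or => /andP[] ? /IHl; lia.
have sumd : sumn (drop_column l) = (sumn l - size l)%N.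
  rewrite -[in RHS](drop_columnK sl l0) sumn_add_column ?size_drop_column //.
  by rewrite size_add_column ?size_drop_column // addKn.
rewrite enum_partsS szl; apply/allpairsPdep.
exists (size (drop_column l)), (drop_column l); split.
- by rewrite mem_iota /= ltnS size_drop_column.
- rewrite -sumd; apply: IHk.
  + apply: (@homo_sorted _ _ predn geq); first by move=> x y /=; lia.
    by apply: sorted_filter => //; exact: rev_trans leq_trans.
  + by apply/mapP => -[x]; rewrite mem_filter => /andP[]; lia.
  + apply/allP => y /mapP[x]; rewrite mem_filter => /andP[_ /(allP lk)] /= ? ->.
    lia.
- by rewrite drop_columnK.
Qed.

(** An entry determines the pair it came from: [drop_column] recovers [l], and [s] is the size of
    [l]. *)
Lemma enum_parts_uniq (k n r : nat) : uniq (enum_parts k n r).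
Proof.
elim: k n r => [|k IHk] n r; rewrite ?enum_partsS.
  by rewrite /=; case: ifP.
case: ifP => // _; apply: allpairs_uniq_dep => //; first exact: iota_uniq.
move=> x y /allpairsPdep[s [l [_ Hl ->]]] /allpairsPdep[t [m [_ Hm ->]]] /=.
have [_ l0 _ <-] := enum_partsP Hl; have [_ m0 _ <-] := enum_partsP Hm => eq_lm.
by rewrite -(add_columnK r l0) eq_lm add_columnK.
Qed.

(** * Weights of partitions and their total *)

Section Weight.
Variables (R : realType) (p : R).
Hypothesis p_gt1 : 1 < p.

Local Notation Q := (qpoch p p^-1).

Lemma qpochE (k : nat) : Q k = \prod_(0 <= j < k) (1 - p^-1 ^+ j.+1).
Proof. by apply: eq_bigr => j _; rewrite exprS exprVn. Qed.

Lemma qpoch0 (x : R) : qpoch p x 0 = 1.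
Proof. by rewrite /qpoch big_nil. Qed.

Lemma qpoch_gt0 (k : nat) : 0 < Q k.
Proof.
rewrite qpochE; apply: prodr_gt0 => j _; rewrite subr_gt0 exprn_ilt1 //.
  by rewrite invr_ge0 ltW // (lt_trans ltr01).
by rewrite invf_lt1 // (lt_trans ltr01).
Qed.

Lemma qpoch_neq0 (k : nat) : Q k != 0.
Proof. by rewrite gt_eqF ?qpoch_gt0. Qed.

Lemma qbinom_qpoch (a b : nat) :
  qbinom p^-1 (a + b) a = Q (a + b)%N / (Q a * Q b).
Proof. by rewrite !qpochE -qbinomM mulfK // -!qpochE mulf_neq0 ?qpoch_neq0. Qed.

(* Columns beyond [N] are ignored, so [N] must bound the parts of [l]. *)
Definition weight (N : nat) (l : seq nat) : R :=
  (p ^+ (\sum_(1 <= i < N.+1) count (leq i) l ^ 2)%N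
   * \prod_(1 <= i < N.+1) Q (count_mem i l))^-1.

(** All columns and multiplicities shift by one index; the only new data are the first column, of
    height [r], and the [r - size l] parts equal to 1. *)
Lemma weight_add_column (N r : nat) (l : seq nat) :
  0%N \notin l -> (size l <= r)%N ->
  weight N.+1 (add_column r l) =
  (p ^+ (r ^ 2)%N * Q (r - size l)%N)^-1 * weight N l.
Proof.
move=> l0 ler; rewrite /weight -invfM; congr (_^-1).
have c1 : count (leq 1) (add_column r l) = r.
  rewrite -[RHS](size_add_column ler); apply/eqP; rewrite -all_count.
  by apply/allP => -[] // /(negP (add_column_neq0 _ _)).
have cS i : count (leq i.+2) (add_column r l) = count (leq i.+1) l.
  by rewrite count_cat count_map count_nseq addn0.
have m1 : count_mem 1%N (add_column r l) = (r - size l)%N.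
  rewrite count_cat count_map count_nseq mul1n (eq_count (a2 := pred1 0%N)) //.
  by rewrite (count_memPn l0).
have mS i : count_mem i.+2 (add_column r l) = count_mem i.+1 l.
  by rewrite count_cat count_map count_nseq addn0.
rewrite !big_add1 /= big_nat_recl // [X in _ * X = _]big_nat_recl //= c1 m1 exprD.
under eq_bigr do rewrite cS.
under [X in _ * (_ * X) = _]eq_bigr do rewrite mS.
by ring.
Qed.

(** Lets all partitions of [n] share the bound [n], where [Pdu] stops at the largest part of
    each. *)
Lemma weight_widen (N M : nat) (l : seq nat) :
  (N <= M)%N -> all (fun x => x <= N)%N l -> weight M l = weight N l.
Proof.
move=> leNM lN; rewrite /weight; congr ((p ^+ _ * _)^-1).
  rewrite (big_cat_nat (n := N.+1)) //= [X in (_ + X)%N]big1_seq.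
    by rewrite addn0.
  move=> i; rewrite mem_index_iota => /andP[_ /andP[lti _]].
  apply/eqP; rewrite expn_eq0 /= andbT.
  rewrite eqn0Ngt -has_count; apply/hasPn => x /(allP lN) /=; lia.
rewrite (big_cat_nat (n := N.+1)) //= [X in _ * X]big1_seq.
  by rewrite mulr1.
move=> i; rewrite mem_index_iota => /andP[_ /andP[lti _]].
rewrite (count_memPn _) ?qpoch0 //.
by apply/negP => /(allP lN) /=; lia.
Qed.

Definition weight_sum (k n r : nat) : R :=
  \sum_(l <- enum_parts k n r) weight k l.

Lemma weight_sumS (k n r : nat) : (r <= n)%N ->
  weight_sum k.+1 n r =
  (p ^+ (r ^ 2)%N)^-1 * \sum_(s < r.+1) weight_sum k (n - r) s / Q (r - s)%N.
Proof.
move=> lern; rewrite /weight_sum enum_partsS lern big_allpairs_dep /=.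
rewrite -[0%N :: iota 1 r]/(iota 0 r.+1) -[iota 0 _]/(index_iota 0 r.+1).
rewrite big_mkord big_distrr; apply: eq_bigr => s _ /=.
rewrite mulrCA -invfM big_distrl /= !big_seq.
apply: eq_bigr => l /enum_partsP[_ l0 _ szl].
by rewrite weight_add_column // szl -1?ltnS // mulrC.
Qed.

Lemma weight_sum_gt (k n r : nat) : (n < r)%N -> weight_sum k n r = 0.
Proof.
move=> ltnr; rewrite /weight_sum; case: k => [|k].
  by rewrite /= [r == _]gtn_eqF ?(leq_ltn_trans _ ltnr) // andbF big_nil.
by rewrite enum_partsS leqNgt ltnr big_nil.
Qed.

Lemma weight_sum0 (k n : nat) : weight_sum k n 0 = (n == 0%N)%:R.
Proof.
elim: k => [|k IHk].
  rewrite /weight_sum /= andbT; case: eqP => _; last by rewrite big_nil.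
  by rewrite big_seq1 /weight !big_geq // expr0 mulr1 invr1.
by rewrite weight_sumS // big_ord1 subn0 IHk expr0 invr1 mul1r qpoch0 divr1.
Qed.

(** With [n - r = m.+1], the recursion over the number [s] of remaining parts becomes q-Vandermonde
    for [qbinom p^-1 (m + r) m.+1]. The bound [n <= k] survives the step since [r] is positive. *)
Lemma weight_sumE (k n r : nat) : (n <= k)%N -> (0 < r <= n)%N ->
  weight_sum k n r =
  (p ^+ (r ^ 2)%N * Q r * p ^+ (n - r)%N)^-1 * qbinom p^-1 n.-1 (n - r).
Proof.
elim: k n r => [|k IHk] n r; first by lia.
move=> lenk /andP[r0 lern]; rewrite weight_sumS //.
have : n = ((n - r) + r)%N by rewrite subnK.
move: (n - r)%N => m en; subst n.
case: m => [|m] in lenk lern *.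
  (* Here [n = r]: only the empty partition is left, so only [s = 0] contributes. *)
  rewrite big_ord_recl big1 => [|i _]; last by rewrite weight_sum_gt ?mul0r.
  by rewrite weight_sum0 subn0 addr0 qbinomn0 expr0 !mulr1 mul1r invfM.
rewrite addSn /= qbinom_Vandermonde -mulrA invfM -mulrA; congr (_ * _).
(* The Vandermonde index is [m.+1 - s]. Both sums are then widened to a common range of [s]; terms
   with [s = 0], [s > r] or [s > m.+1] vanish on both sides. *)
rewrite [X in _ = _ * X](reindex_inj rev_ord_inj) /=.
rewrite (big_ord_widen (r + m).+2 (fun s => weight_sum k m.+1 s / Q (r - s)%N));
  last lia.
rewrite [X in _ = _ * X](big_ord_widen (r + m).+2 (fun s =>
  qbinom p^-1 m (m.+2 - s.+1) * qbinom p^-1 r (m.+1 - (m.+2 - s.+1))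
  * p^-1 ^+ ((m.+1 - (m.+2 - s.+1)) * (m - (m.+2 - s.+1)))%N)); last lia.
rewrite big_distrr [LHS]big_mkcond [RHS]big_mkcond.
apply: eq_bigr => -[s _] _ /=.
rewrite !ltnS subSS.
have [lesm|ltms] := leqP s m.+1; last by rewrite weight_sum_gt // mul0r if_same.
rewrite subKn //.
have [lesr|ltrs] := leqP s r; last first.
  by rewrite (qbinom_small _ ltrs) mulr0 mul0r mulr0.
have [->|s0] := posnP s.
  by rewrite weight_sum0 mul0r subn0 (qbinom_small _ (ltnSn m)) !mul0r mulr0.
rewrite IHk //; [|lia|lia].
have -> : qbinom p^-1 r s = Q r / (Q s * Q (r - s)%N).
  by rewrite -{1 2}(subnKC lesr) qbinom_qpoch.
have -> : (m - (m.+1 - s) = s.-1)%N by lia.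
rewrite exprVn [m.+1.-1]/=.
(* The powers of [p] agree because [s ^ 2 + (m.+1 - s) = s * s.-1 + m.+1], where [s * s.-1] is the
   Vandermonde exponent. *)
have -> : p ^+ m.+1 = p ^+ s * p ^+ (m.+1 - s) by rewrite -exprD subnKC.
have -> : (s ^ 2 = s + s * s.-1)%N by rewrite -mulnn -mulnS prednK.
rewrite exprD !invfM.
have QV : Q r * (Q r)^-1 = 1 by rewrite divff ?qpoch_neq0.
(* [Q r] occurs only on the right, with its inverse; [ring] does not cancel them, so the pair is
   inserted on the left. *)
transitivity ((Q r * (Q r)^-1) * ((p ^+ s)^-1 * (p ^+ (s * s.-1))^-1 / Q s
   / p ^+ (m.+1 - s) * qbinom p^-1 m (m.+1 - s) / Q (r - s)%N)).
  by rewrite QV; ring.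
by ring.
Qed.

Lemma weight_ge0 (N : nat) (l : seq nat) : 0 <= weight N l.
Proof.
have p0 : 0 < p by apply: lt_trans p_gt1.
rewrite invr_ge0 mulr_ge0 ?exprn_ge0 ?(ltW p0) //.
by apply: prodr_ge0 => i _; exact: ltW (qpoch_gt0 _).
Qed.

(** * The measure and the event *)

Lemma qpoch_div (x : R) (k : nat) :
  qpoch p (x / p) k = \prod_(1 <= i < k.+1) (1 - x / p ^+ i).
Proof.
by rewrite big_add1 /=; apply: eq_bigr => i _; rewrite exprS invfM mulrA.
Qed.

(** The product is what remains of [Q d] after its first [d - r] factors. *)
Lemma qpoch_divr (d r : nat) : (r <= d)%N ->
  \prod_((d - r).+1 <= i < d.+1) (1 - 1 / p ^+ i) = Q d / Q (d - r)%N.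
Proof.
move=> lerd; apply: (mulIf (qpoch_neq0 (d - r))); rewrite divfK ?qpoch_neq0 //.
rewrite -[p^-1]mul1r !qpoch_div mulrC -big_cat_nat //=; lia.
Qed.

Lemma npartsE (l : intpart) : nparts l = size l.
Proof.
have /andP[_ l0] := valP l; rewrite /nparts /col.
by apply/eqP; rewrite -all_count; apply/allP => -[] // /(negP l0).
Qed.

Lemma all_geq_largest (l : intpart) : all (fun x => x <= largest l)%N l.
Proof.
case: l => -[//|x l] xl; have /andP[sl _] := xl; rewrite /largest /= leqnn /=.
exact: order_path_min (rev_trans leq_trans) sl.
Qed.

Lemma largest_leq_psize (l : intpart) : (largest l <= psize l)%N.
Proof. by case: l => -[//|x l] xl; exact: leq_addr. Qed.

Lemma Pdu_weight (d : nat) (u : R) (l : intpart) : (nparts l <= d)%N ->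
  Pdu p d u l =
  u ^+ psize l * qpoch p (u / p) d * (Q d / Q (d - nparts l)%N)
  * weight (psize l) l.
Proof.
move=> led; rewrite /Pdu led qpoch_divr // -qpoch_div.
rewrite (weight_widen (largest_leq_psize l) (all_geq_largest l)) /weight.
by rewrite -/(mult _ l); ring.
Qed.

(** The event is finite: its members are the entries of [enum_parts n n r], as no part exceeds [n].
    Since these entries are bare sequences, [g] replaces [f]. *)
Lemma esum_parts (f : intpart -> R) (g : seq nat -> R) (n r : nat) :
  (forall l : intpart, psize l = n -> nparts l = r -> f l = g l) ->
  (forall l, 0 <= g l) ->
  (\esum_(l in [set l : intpart | psize l = n /\ nparts l = r]) (f l)%:E)%E =
  (\sum_(l <- enum_parts n n r) g l)%:E.
Proof.
move=> fg g0; set A := [set l | _]%classic.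
pose s : seq intpart := pmap insub (enum_parts n n r).
have As : A = [set` s]%classic.
  apply/seteqP; split => l /=; rewrite mem_pmap_sub.
    move=> [<- <-]; rewrite npartsE; have /andP[sl l0] := valP l.
    apply: mem_enum_parts => //; apply: sub_all (all_geq_largest l) => x /= xl.
    exact: leq_trans xl (largest_leq_psize l).
  by move=> /enum_partsP[_ _ ? ?]; split; rewrite ?npartsE.
have us : uniq s by rewrite pmap_sub_uniq ?enum_parts_uniq.
rewrite esum_fset; first last.
- by move=> l; rewrite inE => -[ln lr]; rewrite lee_fin fg.
- by rewrite As; exact: finite_seq.
rewrite As -fsbig_seq // sumEFin; congr (_%:E).
(* Every entry is a valid partition, so [insub] discards none. *)
have -> : enum_parts n n r = map val s.
  rewrite (pmap_filter (insubK _)); apply/esym/all_filterP/allP => l.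
  by move=> /enum_partsP[sl l0 _ _]; rewrite insubT ?sl.
rewrite big_map !big_seq; apply: eq_bigr => l ls.
have : A l by rewrite As.
by case=> ln lr; rewrite fg.
Qed.

End Weight.

Theorem theorem2p5 (R : realType) (p u : R) (d n r : nat)
    (hp : 1 < p) (hu0 : 0 < u) (hup : u < p) (hd : (0 < d)%N)
    (hr1 : (1 <= r)%N) (hr : (r <= minn d n)%N) :
  Pr_du p d u [set l : intpart | psize l = n /\ nparts l = r]%classic =
  ((u ^+ n * qpoch p (u / p) d * qpoch p p^-1 d)
     / (p ^+ (r ^ 2)%N * qpoch p p^-1 (d - r)%N * qpoch p p^-1 r)
   * (qpoch p p^-1 (n - 1)%N
      / (p ^+ (n - r)%N * qpoch p p^-1 (r - 1)%N * qpoch p p^-1 (n - r)%N)))%:E.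
Proof.
move: hr; rewrite leq_min => /andP[lerd lern].
have p0 : 0 < p by apply: lt_trans hp.
(* The factor of [Pdu] common to all partitions in the event. *)
pose c := u ^+ n * qpoch p (u / p) d * (qpoch p p^-1 d / qpoch p p^-1 (d - r)).
have c0 : 0 <= c.
  rewrite !mulr_ge0 ?invr_ge0 ?exprn_ge0 ?(ltW hu0) ?(ltW (qpoch_gt0 hp _)) //.
  (* Each factor of [qpoch p (u / p) d] is nonnegative because [u / p <= 1 <= p ^+ j]. *)
  rewrite prodr_ge0 // => j _; rewrite subr_ge0 ler_pdivrMr ?exprn_gt0 // mul1r.
  rewrite (le_trans (y := 1)) ?ler_pdivrMr ?mul1r ?(ltW hup) //.
  by rewrite exprn_ege1 ?ltW.
rewrite /Pr_du (@esum_parts _ _ (fun l => c * weight p n l)); first last.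
- by move=> l; rewrite mulr_ge0 ?weight_ge0.
- by move=> l ln lr; rewrite Pdu_weight ?ln ?lr.
rewrite -big_distrr -/(weight_sum p n n r) weight_sumE ?hr1 //; congr (_%:E).
(* This splitting, valid as [1 <= r <= n], turns the Gaussian binomial into the quotient in the
   statement. *)
have -> : n.-1 = ((n - r) + (r - 1))%N by lia.
rewrite qbinom_qpoch // (_ : (n - r + (r - 1) = n - 1)%N); last by lia.
by rewrite /c !invfM /=; ring.
Qed.
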